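(* Assume that $\mu$ is diffuse (i.e. for any measurable $A$ and any $0 \leq \alpha \leq \mu(A)$ there exists a measurable $B\subseteq A$ such that $\mu(B)=\alpha$). Assume that there exist constants $C>0$ and $\lambda_0>0$ such that for all measurable $V:E\to\mathbb{R}$ with $\int V d\mu=0$ and $\sup |V|= 1$, and all $0 \leq \lambda \leq \lambda_0$, $$\Lambda(\lambda V)\leq C \lambda^2 .$$ Then $\mu$ satisfies a Poincaré inequality, i.e. there exists a constant $C_P<+\infty$ such that $\mathrm{Var}_\mu(f)\le -C_P\,\langle Lf,f\rangle_\mu$ for all $f\in D(L)$.
   Context: $E$ is a Polish space and $(X_t,(\mathbb{P}_x)_{x\in E})$ is a conservative continuous-time Markov process on $E$ with semigroup $(P_t)_{t\ge 0}$ and infinitesimal generator $L$ with domain $D(L)$ (in $\mathbb{L}^2(\mu)$). $\mu$ is a probability measure on $E$ that is invariant and ergodic for $(P_t)$ (not assumed symmetric). $\langle\cdot,\cdot\rangle_\mu$ is the inner product of $\mathbb{L}^2(\mu)$ and $\mathrm{Var}_\mu(f)=\int f^2d\mu-(\int f d\mu)^2$. For a bounded function $V$, $$\Lambda(V) := \sup \left\{ \int V f^2 \, d\mu + \langle Lf,f\rangle_\mu \; ; \; f\in D(L),\ \int f^2 d\mu =1 \right\}.$$ *)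

(* Defs.v *)
From HB Require Import structures.
From mathcomp Require Import all_boot all_order all_algebra.
From mathcomp Require Import all_classical all_reals all_analysis.
Set Implicit Arguments.
Unset Strict Implicit.
Unset Printing Implicit Defensive.
Import Order.TTheory GRing.Theory Num.Theory.
Import numFieldNormedType.Exports.
Local Open Scope classical_set_scope.
Local Open Scope ring_scope.

Notation borel E := (g_sigma_algebraType (@open E)).

(* A Polish space is given with a compatible complete metric: a
   completePseudoMetricType that satisfies the predicate below. The Hausdorff
   condition turns the pseudometric into a metric. *)
Definition polish_space (E : topologicalType) : Prop :=
  hausdorff_space E /\ exists2 S : set E, countable S & dense S.

Section MarkovProcess.
Context {R : realType} {d dO : measure_display}.
Context {E : measurableType d} {Omega : measurableType dO}.

(* The sigma-algebra of the past up to time s. *)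
Definition past (X : R -> Omega -> E) (s : R) : set (set Omega) :=
  <<s [set B | exists u A, [/\ 0 <= u <= s, measurable A & B = X u @^-1` A]] >>.

(* Times range over the nonnegative elements of R. The process is conservative
   because every X t takes its values in E (there is no cemetery point) and
   every Px x has mass 1. The last clause is
   Px x (X_{s+t} \in A | past X s) = Px (X s) (X_t \in A), with the conditional
   probability written through its integrals over the events of the past. *)
Definition markov_process (X : R -> Omega -> E) (Px : R.-pker E ~> Omega) :
    Prop :=
  [/\ forall t, 0 <= t -> measurable_fun [set: Omega] (X t),
      forall x A, measurable A -> Px x (X 0 @^-1` A) = \d_x A :> \bar R
    & forall x s t A B, 0 <= s -> 0 <= t -> measurable A -> past X s B ->
        Px x (B `&` X (s + t) @^-1` A) =
        (\int[Px x]_(w in B) Px (X s w) (X t @^-1` A))%E].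

(* P_t f (x) = E_x[f(X_t)] *)
Definition semigroup (X : R -> Omega -> E) (Px : R.-pker E ~> Omega)
    (t : R) (f : E -> R) : E -> R :=
  fun x => \int[Px x]_w f (X t w).

Definition invariant_measure (X : R -> Omega -> E) (Px : R.-pker E ~> Omega)
    (mu : probability E R) : Prop :=
  forall t A, 0 <= t -> measurable A ->
    (\int[mu]_x Px x (X t @^-1` A) = mu A)%E.

Definition ergodic_measure (X : R -> Omega -> E) (Px : R.-pker E ~> Omega)
    (mu : probability E R) : Prop :=
  forall f : E -> R, f \in Lfun mu 2%:E ->
    (forall t, 0 <= t -> {ae mu, forall x, semigroup X Px t f x = f x}) ->
    exists c : R, {ae mu, forall x, f x = c}.

(* Elements of L^2(mu) are represented by functions. The relation below says
   that (P_t f - f) / t tends to g in L^2(mu) as t decreases to 0. When mu is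
   invariant, f is integrable for the law of X_t under Px x for mu-almost
   every x, and so P_t f is well defined mu-almost everywhere. *)
Definition is_generator (X : R -> Omega -> E) (Px : R.-pker E ~> Omega)
    (mu : probability E R) (f g : E -> R) : Prop :=
  [/\ f \in Lfun mu 2%:E, g \in Lfun mu 2%:E
    & Lnorm mu 2%:E (fun x => ((semigroup X Px t f x - f x) / t - g x)%:E)
        @[t --> 0^'+] --> 0%E].

Definition generator_domain (X : R -> Omega -> E) (Px : R.-pker E ~> Omega)
    (mu : probability E R) : set (E -> R) :=
  [set f | exists g, is_generator X Px mu f g].

(* A representative of L f, which is unique up to mu-almost everywhere equality
   for f in the domain (and the zero function outside the domain). *)
Definition generator (X : R -> Omega -> E) (Px : R.-pker E ~> Omega)
    (mu : probability E R) (f : E -> R) : E -> R :=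
  xget (cst 0) [set g | is_generator X Px mu f g].

Definition inner (mu : probability E R) (f g : E -> R) : R :=
  \int[mu]_x (f x * g x).

Definition Var (mu : probability E R) (f : E -> R) : R :=
  \int[mu]_x (f x ^+ 2) - (\int[mu]_x f x) ^+ 2.

Definition Lambda (X : R -> Omega -> E) (Px : R.-pker E ~> Omega)
    (mu : probability E R) (V : E -> R) : \bar R :=
  ereal_sup
    [set (\int[mu]_x (V x * f x ^+ 2) + inner mu (generator X Px mu f) f)%:E
      | f in [set f | generator_domain X Px mu f /\
                      \int[mu]_x (f x ^+ 2) = 1]].

Definition diffuse (mu : probability E R) : Prop :=
  forall (A : set E) (alpha : R),
    measurable A -> 0 <= alpha -> (alpha%:E <= mu A)%E ->
    exists B, [/\ measurable B, B `<=` A & mu B = alpha%:E].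

Definition poincare_inequality (X : R -> Omega -> E) (Px : R.-pker E ~> Omega)
    (mu : probability E R) : Prop :=
  exists CP : R, forall f, generator_domain X Px mu f ->
    Var mu f <= - CP * inner mu (generator X Px mu f) f.

End MarkovProcess.

(* Main.v *)
Require Import Defs.
From HB Require Import structures.
From mathcomp Require Import all_boot all_order all_algebra.
From mathcomp Require Import all_classical all_reals all_analysis.
From mathcomp Require Import measurable_realfun giry.
From mathcomp Require Import ring lra.
Set Implicit Arguments.
Unset Strict Implicit.
Unset Printing Implicit Defensive.
Import Order.TTheory GRing.Theory Num.Theory.
Import numFieldNormedType.Exports.
Local Open Scope classical_set_scope.
Local Open Scope ring_scope.

(** Fix [f] in the domain, let [g] be [f] minus its mean and [s ^+ 2] the variance
    of [f]. The generator kills constants, and [L f] has mean [0] because [mu] is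
    invariant, so the energy [- <L h, h>] is the same for [h = f], [h = g] and
    [h = g + c]. The hypothesis on [Lambda], homogeneous in [h], says that
      [lambda * \int V h^2 + <L h, h> <= C * lambda^2 * \int h^2]
    for every nonzero centered [V] with [|V| <= 1] and every
    [0 <= lambda <= lambda0] ([Lambda_ge], [Lambda_le_of_bounded]). For the Poincaré inequality it suffices to find,
    for each [g] with [s > 0], some [V] and some constant [c] such that
    [\int V (g + c)^2] is at least a fixed fraction of [s^2] while
    [\int (g + c)^2] is at most a fixed multiple of [s^2]: a small [lambda],
    depending only on [C] and [lambda0], then makes the quadratic term negligible.

    Such a pair exists by a dichotomy on the L^1 norm of [g]
    ([exists_test_function]); in both cases [V] is the indicator of a set minus
    its mass. If [\int |g| >= s / 4], take the set where [g >= 0] and [c = 8 s]: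
    [\int V g = \int |g| / 2] is of order [s], and the shift by [c] turns it into
    a cross term of order [s^2] which beats the contribution of [V g^2]. If
    [\int |g| < s / 4], then [g^2] lives mostly on the set where [|g| > s], whose
    mass is at most [1/4] by Markov's inequality, and [c = 0] works with that set.

    Only affine images of [f] are fed to [L]: the domain of a generator is stable
    under affine maps, but in general not under truncation. *)

(** * Invariance of the measure, extended from sets to functions *)

Section KernelLaw.
Context (R : realType) (d dO : measure_display) (E : measurableType d).
Context (Omega : measurableType dO) (Px : R.-pker E ~> Omega).

(** The measure [Px x], carried as a probability measure: this makes constants
    integrable for it and lets [mu] be composed with the kernel in the Giry monad. *)
Definition kernel_law (x : E) : set Omega -> \bar R := Px x.

HB.instance Definition _ x := Measure.on (kernel_law x).

Fact kernel_law_setT x : kernel_law x [set: Omega] = 1%E.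
Proof. exact: prob_kernel. Qed.

HB.instance Definition _ x :=
  Measure_isProbability.Build _ _ _ (kernel_law x) (kernel_law_setT x).

Lemma measurable_kernel_law :
  measurable_fun [set: E] (fun x => kernel_law x : giry Omega R).
Proof.
by apply: measurable_giry_codensity => // B mB; exact: measurable_kernel.
Qed.

End KernelLaw.

Lemma ae_eq_integrable (R : realType) (d : measure_display)
    (T : measurableType d) (mu : {measure set T -> \bar R})
    (f g : T -> \bar R) :
    measurable_fun [set: T] g -> ae_eq mu [set: T] f g ->
  mu.-integrable [set: T] f -> mu.-integrable [set: T] g.
Proof.
move=> mg fg /integrableP[mf foo]; apply/integrableP; split => //.
rewrite (ae_eq_integral (abse \o f))//; [exact: measurableT_comp..|].
by apply: filterS fg => x fgx /fgx /= ->.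
Qed.

Section Semigroup.
Context (R : realType) (d dO : measure_display) (E : measurableType d).
Context (Omega : measurableType dO) (X : R -> Omega -> E).
Context (Px : R.-pker E ~> Omega) (mu : probability E R).
Hypothesis mX : forall t, 0 <= t -> measurable_fun [set: Omega] (X t).
Hypothesis hinv : invariant_measure X Px mu.

Local Notation P := (semigroup X Px).

(** The law of [X t] under [mu Px] is [mu]: integrate [F] against the bind of
    [mu] with the kernel, pushed forward by [X t]. *)
Lemma invariant_ge0_integral t (F : E -> \bar R) : 0 <= t ->
    measurable_fun [set: E] F -> (forall x, 0 <= F x)%E ->
  (\int[mu]_x \int[Px x]_w F (X t w) = \int[mu]_x F x)%E.
Proof.
move=> t0 mF F0.
have mFX : measurable_fun [set: Omega] (F \o X t).
  by apply: measurableT_comp => //; exact: mX.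
have := giry_int_bind (mu : giry E R) (measurable_kernel_law Px) mFX
  (fun w => F0 (X t w)).
rewrite /giry_int => <-.
set nu := giry_bind _ _.
transitivity (\int[pushforward nu (X t)]_y F y)%E.
  by rewrite ge0_integral_pushforward //; exact: mX.
apply: eq_measure_integral; first exact: mX.
move=> mXt A mA _.
rewrite -[RHS](hinv t0 mA).
have mXA : measurable (X t @^-1` A).
  by rewrite -[_ @^-1` _]setTI; exact: mX.
transitivity (\int[nu]_w (\1_(X t @^-1` A) w)%:E)%E.
  by rewrite integral_indic// setIT.
rewrite [LHS](giry_int_bind (mu : giry E R) (measurable_kernel_law Px)).
- by apply: eq_integral => x _; rewrite /giry_int integral_indic// setIT.
- exact/measurable_EFinP.
- by move=> w; rewrite lee_fin.
Qed.

Lemma measurable_ge0_kernel_integral t (F : E -> \bar R) : 0 <= t ->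
    measurable_fun [set: E] F -> (forall x, 0 <= F x)%E ->
  measurable_fun [set: E] (fun x => \int[Px x]_w F (X t w))%E.
Proof.
move=> t0 mF F0; apply:
  (@measurable_fun_integral_kernel _ _ _ _ _ Px _ (F \o X t)).
- by move=> U mU; exact: measurable_kernel.
- by move=> w; exact: F0.
- by apply: measurableT_comp => //; exact: mX.
Qed.

Lemma integral_lawE t x (f : E -> R) :
  (\int[Px x]_w (f (X t w))%:E =
   \int[Px x]_w ((EFin \o f)^\+)%E (X t w) -
   \int[Px x]_w ((EFin \o f)^\-)%E (X t w))%E.
Proof.
by rewrite integralE; congr (_ - _)%E; apply: eq_integral => w _;
  rewrite ?funeposE ?funenegE.
Qed.

Lemma measurable_semigroup t (f : E -> R) : 0 <= t ->
  measurable_fun [set: E] f -> measurable_fun [set: E] (P t f).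
Proof.
move=> t0 mf; rewrite /semigroup /Rintegral.
apply: (measurableT_comp (fine_measurable _)) => //.
under eq_fun do rewrite integral_lawE.
apply: emeasurable_funB.
- apply: (@measurable_ge0_kernel_integral t ((EFin \o f)^\+)%E) => //.
  by apply: measurable_funepos; exact/measurable_EFinP.
- apply: (@measurable_ge0_kernel_integral t ((EFin \o f)^\-)%E) => //.
  by apply: measurable_funeneg; exact/measurable_EFinP.
Qed.


Lemma invariant_ge0_ae_fin t (F : E -> \bar R) : 0 <= t ->
    measurable_fun [set: E] F -> (forall x, 0 <= F x)%E ->
    (\int[mu]_x F x < +oo)%E ->
  mu.-integrable [set: E] (fun x => \int[Px x]_w F (X t w))%E.
Proof.
move=> t0 mF F0 Foo; apply/integrableP; split.
  exact: measurable_ge0_kernel_integral.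
under eq_integral do rewrite gee0_abs ?integral_ge0//.
by rewrite invariant_ge0_integral.
Qed.

(** Invariance gives [|f (X t)|] a finite integral under [mu Px], so that
    [P t f x] is a genuine integral for almost every [x] and depends linearly on
    [f] there. *)
Lemma ae_integrable_law t (f : E -> R) : 0 <= t ->
    mu.-integrable [set: E] (EFin \o f) ->
  {ae mu, forall x, (Px x).-integrable [set: Omega] (EFin \o (f \o X t))}.
Proof.
move=> t0 /integrableP[/measurable_EFinP mf foo].
have mabs : measurable_fun [set: E] (fun x => `|(f x)%:E|%E).
  by apply: measurableT_comp => //; exact/measurable_EFinP.
have := invariant_ge0_ae_fin t0 mabs (fun x => abse_ge0 _) foo.
move=> /(integrable_ae measurableT); apply: filterS => x /(_ I) xoo.
apply/integrableP; split.
  by apply/measurable_EFinP/measurableT_comp => //; exact: mX.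
by rewrite -ge0_fin_numE// integral_ge0.
Qed.

Lemma integral_semigroup t (f : E -> R) : 0 <= t ->
    mu.-integrable [set: E] (EFin \o f) ->
  mu.-integrable [set: E] (EFin \o P t f) /\
  \int[mu]_x P t f x = \int[mu]_x f x.
Proof.
move=> t0 intf; have [/measurable_EFinP mf foo] := integrableP _ _ _ intf.
have mpos : measurable_fun [set: E] ((EFin \o f)^\+)%E.
  by apply: measurable_funepos; exact/measurable_EFinP.
have mneg : measurable_fun [set: E] ((EFin \o f)^\-)%E.
  by apply: measurable_funeneg; exact/measurable_EFinP.
have posoo : (\int[mu]_x ((EFin \o f)^\+)%E x < +oo)%E.
  by rewrite -ge0_fin_numE ?integral_ge0// integrable_pos_fin_num.
have negoo : (\int[mu]_x ((EFin \o f)^\-)%E x < +oo)%E.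
  by rewrite -ge0_fin_numE ?integral_ge0// integrable_neg_fin_num.
have ip := invariant_ge0_ae_fin t0 mpos (fun x => funepos_ge0 _ _) posoo.
have im := invariant_ge0_ae_fin t0 mneg (fun x => funeneg_ge0 _ _) negoo.
have aeP : ae_eq mu [set: E] (EFin \o P t f)
  (fun x => \int[Px x]_w ((EFin \o f)^\+)%E (X t w) -
            \int[Px x]_w ((EFin \o f)^\-)%E (X t w))%E.
  apply: filterS (ae_integrable_law t0 intf) => x ix _ /=.
  by rewrite -integral_lawE fineK//; exact: (integrable_fin_num _ ix).
have mP : measurable_fun [set: E] (EFin \o P t f).
  by apply/measurable_EFinP; exact: measurable_semigroup.
split.
  apply: ae_eq_integrable mP _ (integrableB measurableT ip im).
  exact: ae_eq_sym.
congr fine.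
rewrite (ae_eq_integral _ _ _ _ _ aeP)//; last first.
  apply: emeasurable_funB; [exact: measurable_int ip|].
  exact: measurable_int im.
by rewrite integralB// !invariant_ge0_integral// -integralE.
Qed.

End Semigroup.

(** * Square-integrable functions on a probability space *)
Section SquareIntegrable.
Context (R : realType) (d : measure_display) (T : measurableType d).
Context (mu : probability T R).
Implicit Types f g : T -> R.

Lemma Lfun_measurable f p : f \in Lfun mu p -> measurable_fun [set: T] f.
Proof. by rewrite inE => /andP[/[!inE]]. Qed.

Lemma Lfun2_integrable f :
  f \in Lfun mu 2%:E -> mu.-integrable [set: T] (EFin \o f).
Proof.
move=> f2; apply/Lfun1_integrable; apply: Lfun_subset12 f2 => /=.
by rewrite (@probability_setT _ _ _ mu).
Qed.

Lemma Lfun2_affine f (k c : R) :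
  f \in Lfun mu 2%:E -> (fun x => k * f x + c) \in Lfun mu 2%:E.
Proof.
move=> f2; have [_ addL] := Lfun_addr_closed mu (lee1n 2).
rewrite (_ : (fun x => _) = k \o* f + cst c); last first.
  by apply/funext => x /=; rewrite mulrC.
by apply: addL; [apply: Lfun_scale; rewrite ?ler1n|exact: Lfun_cst].
Qed.

Lemma Lfun2_integrableM f g :
    f \in Lfun mu 2%:E -> g \in Lfun mu 2%:E ->
  mu.-integrable [set: T] (EFin \o (fun x => f x * g x)).
Proof. by move=> f2 g2; apply/Lfun1_integrable; exact: Lfun2_mul_Lfun1. Qed.

Lemma ae_eq_Lnorm2 f g :
    measurable_fun [set: T] f -> measurable_fun [set: T] g ->
    {ae mu, forall x, f x = g x} ->
  Lnorm mu 2%:E (EFin \o f) = Lnorm mu 2%:E (EFin \o g).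
Proof.
move=> mf mg fg; rewrite unlock /Lnorm; congr (_ `^ _)%E.
have mpow (h : T -> R) : measurable_fun [set: T] h ->
    measurable_fun [set: T] (fun x => (`|(EFin \o h) x| `^ 2)%E).
  move=> mh; rewrite (_ : (fun x => _) = (EFin \o (fun x => `|h x| `^ 2))) //.
  apply/measurable_EFinP; apply: (measurableT_comp (measurable_powR _)) => //.
  exact: measurableT_comp.
apply: ae_eq_integral; [by []|exact: mpow|exact: mpow|].
by apply: filterS fg => x + _ /= => ->.
Qed.

Lemma Lnorm2Z f (k : R) : measurable_fun [set: T] f ->
  Lnorm mu 2%:E (EFin \o (fun x => k * f x)) =
  (`|k|%:E * Lnorm mu 2%:E (EFin \o f))%E.
Proof.
move=> mf; rewrite unlock /Lnorm.
under eq_integral do rewrite /= normrM powRM ?EFinM//.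
rewrite ge0_integralZl//.
- rewrite poweRM ?integral_ge0//; congr (_ * _)%E.
    by rewrite poweR_EFin -powRrM mulfV ?powRr1.
- apply/measurable_EFinP; apply: (measurableT_comp (measurable_powR _)) => //.
  exact: measurableT_comp.
Qed.

(** Hölder's inequality against the constant [1], which has norm [1]. *)
Lemma Lnorm1_le_Lnorm2 f : measurable_fun [set: T] f ->
  (\int[mu]_x `|(f x)%:E| <= Lnorm mu 2%:E (EFin \o f))%E.
Proof.
move=> mf; rewrite -(Lnorm1 mu (EFin \o f)).
have -> : Lnorm mu 1%E (EFin \o f) = Lnorm mu 1%E (EFin \o (f \* cst 1)).
  by apply: eq_Lnorm => x /=; rewrite mulr1.
have muT : (mu : {measure set T -> \bar R}) [set: T] = 1%E.
  exact: probability_setT.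
have -> : Lnorm mu 2%:E (EFin \o f) =
    (Lnorm mu 2%:E (EFin \o f) * Lnorm mu 2%:E (EFin \o cst 1%R))%E.
  by rewrite Lnorm_cst1 muT poweR_EFin powR1 mule1.
by apply: hoelder => //; rewrite [RHS]splitr !div1r.
Qed.

End SquareIntegrable.

(** * The generator: uniqueness, affine maps, mean zero *)

Section Generator.
Context (R : realType) (d dO : measure_display) (E : measurableType d).
Context (Omega : measurableType dO) (X : R -> Omega -> E).
Context (Px : R.-pker E ~> Omega) (mu : probability E R).
Hypothesis mX : forall t, 0 <= t -> measurable_fun [set: Omega] (X t).
Hypothesis hinv : invariant_measure X Px mu.

Local Notation P := (semigroup X Px).
Local Notation L := (generator X Px mu).
Local Notation is_gen := (is_generator X Px mu).
Local Notation D := (generator_domain X Px mu).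
Local Notation residual f g t := (fun x => (P t f x - f x) / t - g x).

Lemma measurable_residual f g t : 0 < t -> is_gen f g ->
  measurable_fun [set: E] (residual f g t).
Proof.
move=> t0 [/Lfun_measurable mf /Lfun_measurable mg _].
apply: measurable_funB => //; apply: measurable_funM => //.
by apply: measurable_funB => //; apply: measurable_semigroup => //; exact: ltW.
Qed.

Lemma ae_semigroup_affine t f (k c : R) : 0 <= t ->
    mu.-integrable [set: E] (EFin \o f) ->
  {ae mu, forall x, P t (fun y => k * f y + c) x = k * P t f x + c}.
Proof.
move=> t0 intf; apply: filterS (ae_integrable_law mX hinv t0 intf) => x ix.
have ikf : (Px x).-integrable [set: Omega] (EFin \o (fun w => k * f (X t w))).
  exact: (integrableZl measurableT k ix).
have ic : (Px x).-integrable [set: Omega] (EFin \o cst c).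
  exact: (finite_measure_integrable_cst (kernel_law Px x)).
rewrite /semigroup (RintegralD _ ikf ic)//.
by rewrite (RintegralZl _ _ ix)// Rintegral_cst// prob_kernel mulr1.
Qed.

(** [P t] commutes almost everywhere with affine maps, constants cancel in the
    difference quotient, and the residual is multiplied by [k]. *)
Lemma is_generator_affine f g (k c : R) :
  is_gen f g -> is_gen (fun x => k * f x + c) (fun x => k * g x).
Proof.
move=> fg; have [f2 g2 cvg_fg] := fg.
have kg2 : (fun x => k * g x) \in Lfun mu 2%:E.
  rewrite (_ : (fun x => k * g x) = (fun x => k * g x + 0)); last first.
    by apply/funext => x; rewrite addr0.
  exact: Lfun2_affine.
have kf2 := Lfun2_affine k c f2.
split => //.
have -> : 0%E = (`|k|%:E * 0)%E :> \bar R by rewrite mule0.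
apply: cvg_trans (cvgeZl (y := `|k|%:E) _ cvg_fg) => //.
apply: near_eq_cvg; near=> t.
have t0 : 0 < t by near: t; exact: nbhs_right_gt.
rewrite -(Lnorm2Z mu k (measurable_residual t0 fg)); apply: ae_eq_Lnorm2.
- by apply: measurable_funM => //; exact: measurable_residual.
- apply: measurable_funB; last exact: Lfun_measurable kg2.
  apply: measurable_funM => //; apply: measurable_funB.
    by apply: measurable_semigroup; [|exact: ltW|exact: Lfun_measurable kf2].
  exact: Lfun_measurable kf2.
- apply: filterS (ae_semigroup_affine k c (ltW t0) (Lfun2_integrable f2)).
  by move=> x ->; ring.
Unshelve. all: by end_near. Qed.

(** Uniqueness of limits in L^2. Measurability of the residuals is what makes
    the triangle inequality available. *)
Lemma is_generator_unique f g1 g2 : is_gen f g1 -> is_gen f g2 ->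
  {ae mu, forall x, g1 x = g2 x}.
Proof.
move=> fg1 fg2.
have [/Lfun_measurable mf /Lfun_measurable mg1 c1] := fg1.
have [_ /Lfun_measurable mg2 c2] := fg2.
have mg : measurable_fun [set: E] (fun x => g1 x - g2 x).
  exact: measurable_funB.
suff N0 : Lnorm mu 2%:E (EFin \o (fun x => g1 x - g2 x)) = 0%E.
  have mgE : measurable_fun [set: E] (EFin \o (fun x => g1 x - g2 x)).
    exact/measurable_EFinP.
  have := Lnorm_eq0_eq0 mgE _ N0; rewrite lte_fin => /(_ (ltr0n _ 2)).
  by apply: filterS => x /(_ I)[] /eqP; rewrite subr_eq0 => /eqP.
apply/eqP; rewrite eq_le Lnorm_ge0 andbT.
have c12 : (Lnorm mu 2%:E (EFin \o residual f g1 t) +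
    Lnorm mu 2%:E (EFin \o residual f g2 t))%E @[t --> 0^'+] --> 0%E.
  by rewrite -[X in _ --> X](adde0 0%E); exact: cvgeD.
apply: cvge_to_ge c12 _; near=> t.
have t0 : 0 < t by near: t; exact: nbhs_right_gt.
have m1 := measurable_residual t0 fg1; have m2 := measurable_residual t0 fg2.
have m1N : measurable_fun [set: E] (fun x => - residual f g1 t x).
  exact: measurableT_comp m1.
rewrite /= -[X in (_ <= X + _)%E]oppe_Lnorm addeC.
apply: le_trans (eminkowski mu m2 m1N (lee1n 2)).
rewrite le_eqVlt; apply/orP; left; apply/eqP; apply: eq_Lnorm => x /=.
by congr EFin; ring.
Unshelve. all: by end_near. Qed.

(** The difference quotients [(P t f - f) / t] have mean [0] by invariance and
    tend to [g] in L^2, hence in L^1. *)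
Lemma Rintegral_generator_eq0 f g : is_gen f g -> \int[mu]_x g x = 0.
Proof.
move=> fg; have [f2 g2 c] := fg.
have intf := Lfun2_integrable f2; have intg := Lfun2_integrable g2.
apply/eqP; rewrite -normr_eq0 eq_le normr_ge0 andbT -lee_fin.
apply: cvge_to_ge c _; near=> t.
have t0 : 0 < t by near: t; exact: nbhs_right_gt.
apply: le_trans (Lnorm1_le_Lnorm2 _ (measurable_residual t0 fg)).
have [intP PE] := integral_semigroup mX hinv (ltW t0) intf.
have intPf := integrableB measurableT intP intf.
have intq : mu.-integrable [set: E] (EFin \o (fun x => (P t f x - f x) / t)).
  exact: (integrableZr measurableT _ intPf).
have intr : mu.-integrable [set: E] (EFin \o residual f g t).
  exact: (integrableB measurableT intq intg).
have -> : \int[mu]_x g x = - \int[mu]_x residual f g t x.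
  rewrite (RintegralB _ intq intg)// (RintegralZr _ _ intPf)//.
  by rewrite (RintegralB _ intP intf)// PE subrr mul0r sub0r opprK.
rewrite normrN (EFin_normr_Rintegral _ intr)//.
exact: (le_abse_integral _ measurableT (measurable_int _ intr)).
Unshelve. all: by end_near. Qed.

Lemma generatorP f : D f -> is_gen f (L f).
Proof. exact: xgetPex. Qed.

(** The additive constant contributes [c * \int L f = 0]. *)
Lemma inner_generator_affine f (k c : R) : D f ->
  D (fun x => k * f x + c) /\
  inner mu (L (fun x => k * f x + c)) (fun x => k * f x + c) =
  k ^+ 2 * inner mu (L f) f.
Proof.
move=> Df; have gf := generatorP Df; have gh := is_generator_affine k c gf.
set h := (fun x => k * f x + c) in gh *.
have Dh : D h by exists (fun x => k * L f x).
split => //.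
have [f2 Lf2 _] := gf; have [h2 kLf2 _] := gh; have [_ Lh2 _] := generatorP Dh.
have iLf := Lfun2_integrable Lf2.
have iLff := Lfun2_integrableM Lf2 f2.
transitivity (\int[mu]_x (k ^+ 2 * (L f x * f x) + (k * c) * L f x)).
  congr fine; apply: ae_eq_integral => //.
  - apply/measurable_EFinP.
    by apply: measurable_funM; [exact: Lfun_measurable Lh2|exact: Lfun_measurable h2].
  - by apply/measurable_EFinP; apply: measurable_funD; apply: measurable_funM => //;
      first apply: measurable_funM; apply: Lfun_measurable; eassumption.
  - apply: filterS (is_generator_unique (generatorP Dh) gh) => x -> _.
    by congr EFin; rewrite /h; ring.
rewrite RintegralD//.
- by rewrite !RintegralZl// (Rintegral_generator_eq0 gf) mulr0 addr0.
- exact: (integrableZl measurableT _ iLff).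
- exact: (integrableZl measurableT _ iLf).
Qed.

End Generator.

(** * Test functions detecting the variance *)
Section TestFunction.
Context (R : realType) (d : measure_display) (T : measurableType d).
Context (mu : probability T R).
Implicit Types (f g V : T -> R).

Lemma integrable_bounded_mul V f :
    measurable_fun [set: T] V -> (forall x, `|V x| <= 1) ->
    mu.-integrable [set: T] (EFin \o f) ->
  mu.-integrable [set: T] (EFin \o (fun x => V x * f x)).
Proof.
move=> mV V1 intf; apply: (le_integrable measurableT _ _ intf).
  apply/measurable_EFinP; apply: measurable_funM => //.
  by apply/measurable_EFinP; exact: measurable_int intf.
move=> x _ /=; rewrite lee_fin normrM.
by rewrite -[leRHS]mul1r ler_wpM2r.
Qed.

Local Notation Rintegrable f := (mu.-integrable [set: T] (EFin \o f)).

Lemma Rintegrable_cst (c : R) : Rintegrable (fun=> c).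
Proof. exact: (finite_measure_integrable_cst mu c). Qed.

Lemma RintegrableZl f (k : R) :
  Rintegrable f -> Rintegrable (fun x => k * f x).
Proof. by move=> intf; exact: (integrableZl measurableT k intf). Qed.

Lemma RintegrableD f g :
  Rintegrable f -> Rintegrable g -> Rintegrable (fun x => f x + g x).
Proof. by move=> intf intg; exact: (integrableD measurableT intf intg). Qed.

Lemma Rintegral_prob_cst (c : R) : \int[mu]_x c = c.
Proof.
rewrite Rintegral_cst//.
have -> : (mu : {measure set T -> \bar R}) [set: T] = 1%E.
  exact: probability_setT.
by rewrite mulr1.
Qed.

Lemma Rintegral_affine f (k c : R) : mu.-integrable [set: T] (EFin \o f) ->
  \int[mu]_x (k * f x + c) = k * \int[mu]_x f x + c.
Proof.
move=> intf; rewrite (RintegralD _ (RintegrableZl k intf) (Rintegrable_cst c))//.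
by rewrite RintegralZl// Rintegral_prob_cst.
Qed.

Lemma Rintegral_sqr_affine f (c : R) : f \in Lfun mu 2%:E ->
  \int[mu]_x (f x + c) ^+ 2 =
  \int[mu]_x (f x ^+ 2) + 2 * c * \int[mu]_x f x + c ^+ 2.
Proof.
move=> f2; have intf := Lfun2_integrable f2.
have intf2 := Lfun2_integrable_sqr f2.
have int2 : mu.-integrable [set: T] (EFin \o (fun x => (2 * c) * f x + c ^+ 2)).
  by apply: RintegrableD; [exact: RintegrableZl|exact: Rintegrable_cst].
rewrite -addrA -Rintegral_affine// -RintegralD//.
by apply: eq_Rintegral => x _; ring.
Qed.

Definition centered_indic (A : set T) : T -> R := fun x => \1_A x - fine (mu A).

Lemma fine_prob_ge0_le1 (A : set T) : measurable A -> 0 <= fine (mu A) <= 1.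
Proof.
move=> mA; rewrite fine_ge0//=.
by rewrite -lee_fin fineK ?fin_num_measure// probability_le1.
Qed.

Lemma centered_indicP (A : set T) : measurable A ->
  [/\ measurable_fun [set: T] (centered_indic A),
      forall x, `|centered_indic A x| <= 1
    & \int[mu]_x centered_indic A x = 0].
Proof.
move=> mA; have /andP[a0 a1] := fine_prob_ge0_le1 mA.
split.
- by apply: measurable_funB => //; exact: measurable_indic.
- move=> x; rewrite /centered_indic indicE; case: (x \in A) => /=;
  by rewrite ler_norml; apply/andP; split; lra.
- rewrite RintegralB//.
  + by rewrite Rintegral_prob_cst /Rintegral integral_indic// setIT subrr.
  + exact: integrable_indic.
  + exact: Rintegrable_cst.
Qed.

(** The choice of [V] and [c] depends on whether [g] is spread out (its L^1 norm
    is comparable with its L^2 norm [s]) or concentrated on a small set. Only the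
    existence of constants matters: [1 / 2] and [65 = 1 + 8 ^ 2] could be
    replaced by others. *)
Lemma exists_test_function g (s : R) : g \in Lfun mu 2%:E ->
    \int[mu]_x g x = 0 -> 0 < s -> \int[mu]_x (g x ^+ 2) = s ^+ 2 ->
  exists V c, [/\ measurable_fun [set: T] V, forall x, `|V x| <= 1,
    \int[mu]_x V x = 0,
    s ^+ 2 / 2 <= \int[mu]_x (V x * (g x + c) ^+ 2)
  & \int[mu]_x (g x + c) ^+ 2 <= 65 * s ^+ 2].
Proof.
move=> g2 g0 s0 gs; have mg := Lfun_measurable g2.
have intg := Lfun2_integrable g2; have intg2 := Lfun2_integrable_sqr g2.
have intn : mu.-integrable [set: T] (EFin \o (fun x => `|g x|)).
  exact: (integrable_norm intg).
have sqr_int V c : measurable_fun [set: T] V -> (forall x, `|V x| <= 1) ->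
    mu.-integrable [set: T] (EFin \o (fun x => V x * (g x + c) ^+ 2)).
  move=> mV V1; apply: integrable_bounded_mul => //.
  apply: Lfun2_integrable_sqr.
  rewrite (_ : (fun x => g x + c) = (fun x => 1 * g x + c)); last first.
    by apply/funext => x; rewrite mul1r.
  exact: Lfun2_affine.
have Zint (k : R) f : mu.-integrable [set: T] (EFin \o f) ->
    mu.-integrable [set: T] (EFin \o (fun x => k * f x)).
  exact: RintegrableZl.
have [big|small] := leP (s / 4) (\int[mu]_x `|g x|).
(* Spread out: [\int V g] is half of [\int |g|], as [g] has mean [0], and the
   cross term [16 * s * \int V g >= 2 * s ^+ 2] absorbs
   [\int V g ^+ 2 >= - s ^+ 2]. *)
- pose A := [set x | 0 <= g x].
  have mA : measurable A.
    rewrite (_ : A = g @^-1` `[0, +oo[); last first.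
      by apply/seteqP; split => x; rewrite /A /= in_itv /= andbT.
    by rewrite -[_ @^-1` _]setTI; exact: mg.
  have [mV V1 V0] := centered_indicP mA.
  have intV : mu.-integrable [set: T] (EFin \o centered_indic A).
    have := integrable_bounded_mul mV V1 (Rintegrable_cst 1).
    by under eq_fun do rewrite /= mulr1.
  exists (centered_indic A), (8 * s); split => //; last first.
    by rewrite Rintegral_sqr_affine// g0 gs mulr0; lra.
  set a := fine (mu A).
  apply: (@le_trans _ _ (\int[mu]_x ((- 1) * g x ^+ 2 +
    (8 * s * `|g x| + (8 * s * (1 - 2 * a) * g x +
       64 * s ^+ 2 * centered_indic A x))))).
    rewrite !RintegralD ?RintegralZl//; do ?[exact: Zint
      | apply: RintegrableD; exact: Zint
      | apply: RintegrableD; [exact: Zint|];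
          apply: RintegrableD; exact: Zint].
    by rewrite V0 g0 gs !mulr0 !addr0; nra.
  apply: le_Rintegral => //; do ?exact: sqr_int.
    apply: RintegrableD; [exact: Zint|].
    apply: RintegrableD; [exact: Zint|].
    by apply: RintegrableD; exact: Zint.
  move=> x _.
  have : - (g x ^+ 2) <= centered_indic A x * g x ^+ 2.
    have := V1 x; rewrite ler_norml => /andP[V1x _].
    by have := sqr_ge0 (g x); nra.
  have : 16 * s * (centered_indic A x * g x) =
      8 * s * `|g x| + 8 * s * (1 - 2 * a) * g x.
    rewrite /centered_indic indicE -/a; have [Ax|nAx] := boolP (x \in A).
      move: Ax; rewrite inE => Ax; rewrite ger0_norm//=; ring.
    have {nAx}gx : g x < 0 by rewrite ltNge; apply: contra nAx; rewrite inE.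
    by rewrite ltr0_norm//=; ring.
  by move=> ? ?; lra.
(* Concentrated: [V >= 3 / 4] on [A], while off [A] one has [V >= - 1 / 4] and
   [g ^+ 2 <= s * |g|], which is the pointwise bound integrated below. *)
- pose A := [set x | s < `|g x|].
  have mA : measurable A.
    rewrite (_ : A = (fun x => `|g x|) @^-1` `]s, +oo[); last first.
      by apply/seteqP; split => x; rewrite /A /= in_itv /= andbT.
    by rewrite -[_ @^-1` _]setTI; apply: measurableT_comp => //.
  have [mV V1 V0] := centered_indicP mA.
  exists (centered_indic A), 0; split => //; last first.
    by under eq_Rintegral do rewrite addr0; rewrite gs; nra.
  have a4 : fine (mu A) <= 1 / 4.
    have : s * fine (mu A) <= \int[mu]_x `|g x|.
      have -> : s * fine (mu A) = \int[mu]_x (s * \1_A x).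
        by rewrite RintegralZl ?integrable_indic// /Rintegral integral_indic// setIT.
      apply: le_Rintegral => //; first by apply: Zint; exact: integrable_indic.
      move=> x _; rewrite indicE; have [|_] := boolP (x \in A).
        by rewrite inE /A /= mulr1 => /ltW.
      by rewrite mulr0.
    by nra.
  have /andP[a0 a1] := fine_prob_ge0_le1 mA.
  apply: (@le_trans _ _ (\int[mu]_x (3 / 4 * g x ^+ 2 + (- s) * `|g x|))).
    rewrite RintegralD ?RintegralZl//; do ?exact: Zint.
    by rewrite gs; nra.
  apply: le_Rintegral => //; last 2 first.
  - exact: sqr_int.
  - move=> x _; rewrite addr0 /centered_indic indicE.
    have := sqr_ge0 (g x); rewrite -(real_normK (num_real (g x))).
    have := normr_ge0 (g x); have [|] := boolP (x \in A).
      by rewrite inE /A /= => *; nra.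
    rewrite notin_setE /A /= => /negP; rewrite -leNgt => *; nra.
  by apply: RintegrableD; exact: Zint.
Qed.

End TestFunction.

(** * From the bound on Lambda to the Poincaré inequality *)

Section Poincare.
Context (R : realType) (d dO : measure_display) (E : measurableType d).
Context (Omega : measurableType dO) (X : R -> Omega -> E).
Context (Px : R.-pker E ~> Omega) (mu : probability E R).
Hypothesis mX : forall t, 0 <= t -> measurable_fun [set: Omega] (X t).
Hypothesis hinv : invariant_measure X Px mu.

Local Notation L := (generator X Px mu).
Local Notation D := (generator_domain X Px mu).

(** Normalizing [f] in L^2 gives a competitor in the supremum. *)
Lemma Lambda_ge (V f : E -> R) : D f -> 0 < \int[mu]_x (f x ^+ 2) ->
    measurable_fun [set: E] V -> (forall x, `|V x| <= 1) ->
  forall lambda : R,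
  (((lambda * \int[mu]_x (V x * f x ^+ 2) + inner mu (L f) f) /
     \int[mu]_x (f x ^+ 2))%:E <= Lambda X Px mu (fun x => lambda * V x)%R)%E.
Proof.
move=> Df N0 mV V1 lambda; have [f2 _ _] := generatorP Df.
have intf2 := Lfun2_integrable_sqr f2.
set N := \int[mu]_x (f x ^+ 2) in N0 *.
pose k := (Num.sqrt N)^-1.
have k2 : k ^+ 2 = N^-1 by rewrite exprVn sqr_sqrtr// ltW.
have [Dkf innerE] := inner_generator_affine mX hinv k 0 Df.
apply: ereal_sup_ubound; exists (fun x => k * f x + 0).
  split => //.
  under eq_Rintegral do rewrite addr0 exprMn k2.
  by rewrite RintegralZl// mulVf// gt_eqF.
rewrite innerE k2 mulrDl -[N^-1 * _]mulrC; congr (_ + _)%:E.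
have intVf2 := integrable_bounded_mul mV V1 intf2.
rewrite mulrAC -RintegralZl//; apply: eq_Rintegral => x _.
by rewrite addr0 exprMn k2; ring.
Qed.

Variables (C lambda0 : R).
Hypothesis C0 : 0 < C.
Hypothesis lambda0_gt0 : 0 < lambda0.
Hypothesis hLambda : forall V : E -> R,
  measurable_fun [set: E] V -> \int[mu]_x V x = 0 ->
  ereal_sup [set `|V x|%:E | x in [set: E]] = 1%E ->
  forall lambda : R, 0 <= lambda <= lambda0 ->
  (Lambda X Px mu (fun x => lambda * V x)%R <= (C * lambda ^+ 2)%:E)%E.

(** A potential whose supremum norm [s] is below [1] is reduced to norm [1] by
    writing [lambda * V] as [(lambda * s) * (V / s)]; since [s <= 1], this only
    decreases the coefficient. *)
Lemma Lambda_le_of_bounded (V : E -> R) (lambda : R) :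
    measurable_fun [set: E] V -> (forall x, `|V x| <= 1) ->
    \int[mu]_x V x = 0 -> (exists x, V x != 0) -> 0 <= lambda <= lambda0 ->
  (Lambda X Px mu (fun x => lambda * V x)%R <= (C * lambda ^+ 2)%:E)%E.
Proof.
move=> mV V1 V0 [x0 Vx0] /andP[l0 ll0].
set S := [set `|V x|%:E | x in [set: E]].
have S1 : (ereal_sup S <= 1)%E.
  by apply: ge_ereal_sup => _ [x _ <-]; rewrite lee_fin.
have Sx0 : (`|V x0|%:E <= ereal_sup S)%E by apply: ereal_sup_ubound; exists x0.
have Vx0_gt0 : 0 < `|V x0| by rewrite normr_gt0.
have [s SE] : exists s, ereal_sup S = s%:E.
  case: (ereal_sup S) S1 Sx0 => [s _ _|//|//]; by exists s.
move: S1 Sx0; rewrite SE !lee_fin => s1 Vs.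
have s0 : 0 < s by exact: lt_le_trans Vs.
have intV : mu.-integrable [set: E] (EFin \o V).
  have := integrable_bounded_mul mV V1 (Rintegrable_cst mu 1).
  by under eq_fun do rewrite mulr1.
have lsE : (fun x => lambda * V x) = (fun x => (lambda * s) * (s^-1 * V x)).
  by apply/funext => x; rewrite mulrA mulfK// gt_eqF.
rewrite lsE; apply: le_trans (hLambda _ _ _ _) _.
- exact: measurable_funM.
- by rewrite RintegralZl// V0 mulr0.
- rewrite (_ : [set _ | x in _] = [set (s^-1%:E * y)%E | y in S]).
    by rewrite ereal_sup_pZl ?invr_gt0// SE -EFinM mulVf// gt_eqF.
  rewrite /S image_comp; apply: eq_imagel => x _ /=.
  by rewrite normrM gtr0_norm ?invr_gt0// EFinM.
- rewrite mulr_ge0 ?(ltW s0)//=; apply: le_trans ll0.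
  by rewrite -[leRHS]mulr1 ler_wpM2l.
- rewrite lee_fin ler_wpM2l ?(ltW C0)// exprMn -[leRHS]mulr1.
  by rewrite ler_wpM2l ?sqr_ge0// expr_le1// ltW.
Qed.

Lemma poincare_of_Lambda_bound : poincare_inequality X Px mu.
Proof.
(* With this [l], the error [C * l ^+ 2 * (65 * s ^+ 2)] is at most half of the
   gain [l * s ^+ 2 / 2]. *)
pose l := Num.min lambda0 (260 * C)^-1.
have l0 : 0 < l by rewrite lt_min lambda0_gt0 invr_gt0 mulr_gt0.
have lC : 260 * C * l <= 1.
  rewrite -ler_pdivlMl ?mulr_gt0// mulr1; by rewrite ge_min lexx orbT.
have ll0 : l <= lambda0 by rewrite ge_min lexx.
exists (4 / l) => f Df; have [f2 _ _] := generatorP Df.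
pose m := \int[mu]_x f x; pose g x := 1 * f x + - m.
have [Dg innerE] := inner_generator_affine mX hinv 1 (- m) Df.
move: innerE; rewrite expr1n mul1r => <-; rewrite -/g in Dg *.
have intf := Lfun2_integrable f2.
have g2 : g \in Lfun mu 2%:E by exact: Lfun2_affine.
have g0 : \int[mu]_x g x = 0 by rewrite Rintegral_affine// mul1r subrr.
have VarE : Var mu f = \int[mu]_x (g x ^+ 2).
  rewrite /g; under [RHS]eq_Rintegral do rewrite mul1r.
  by rewrite Rintegral_sqr_affine// /Var -/m; ring.
(* If the variance vanishes, [g] is null and so is the energy. *)
have [v0|v0] := leP (\int[mu]_x (g x ^+ 2)) 0.
  suff -> : inner mu (L g) g = 0 by rewrite VarE mulr0.
  have [_ Lg2 _] := generatorP Dg.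
  have gae : {ae mu, forall x, g x = 0}.
    have intg2 := Lfun2_integrable_sqr g2.
    have : (\int[mu]_x `|(EFin \o (fun x => g x ^+ 2)%R) x| = 0)%E.
      under eq_integral do rewrite /= ger0_norm ?sqr_ge0//.
      apply/eqP; rewrite eq_le integral_ge0 ?andbT; last first.
        by move=> x _; rewrite lee_fin sqr_ge0.
      by rewrite -[X in (X <= _)%E]fineK ?integrable_fin_num// lee_fin.
    move/(ae_eq_integral_abs mu measurableT (measurable_int _ intg2)).
    by apply: filterS => x /(_ I)[] /eqP; rewrite sqrf_eq0 => /eqP.
  rewrite /inner -(Rintegral_prob_cst mu 0); congr fine.
  apply: ae_eq_integral => //.
    by apply/measurable_EFinP/measurable_funM; apply: Lfun_measurable; eassumption.
  by apply: filterS gae => x -> _; rewrite mulr0.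
pose s := Num.sqrt (\int[mu]_x (g x ^+ 2)).
have s0 : 0 < s by rewrite sqrtr_gt0.
have sE : \int[mu]_x (g x ^+ 2) = s ^+ 2 by rewrite sqr_sqrtr// ltW.
have [V [c [mV V1 V0 lbV ubN]]] := exists_test_function g2 g0 s0 sE.
have [Dh innerE] := inner_generator_affine mX hinv 1 c Dg.
have h_eq : (fun x => 1 * g x + c) = (fun x => g x + c).
  by apply/funext => x; rewrite mul1r.
rewrite h_eq expr1n mul1r in Dh innerE.
have N0 : 0 < \int[mu]_x (g x + c) ^+ 2.
  by rewrite Rintegral_sqr_affine// g0 mulr0 addr0 ltr_wpDr ?sqr_ge0.
have Vneq0 : exists x, V x != 0.
  apply/not_existsP => V_0.
  suff : \int[mu]_x (V x * (g x + c) ^+ 2) = 0.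
    by move=> V_int0; move: lbV; rewrite V_int0; have := exprn_gt0 2 s0; lra.
  rewrite -[RHS](Rintegral_prob_cst mu 0); apply: eq_Rintegral => x _.
  by move: (V_0 x) => /negP; rewrite negbK => /eqP ->; rewrite mul0r.
have := le_trans (Lambda_ge Dh N0 mV V1 l)
  (Lambda_le_of_bounded mV V1 V0 Vneq0 _).
rewrite (ltW l0) ll0 => /(_ isT); rewrite lee_fin innerE ler_pdivrMr//.
rewrite VarE sE; set I := inner _ _ _ => bound.
have s20 := exprn_gt0 2 s0.
have : 0 <= C * l ^+ 2 by rewrite mulr_ge0 ?sqr_ge0 ?ltW.
move=> Cl0; have := ler_wpM2l Cl0 ubN => b1.
have b2 := ler_wpM2l (ltW l0) lbV.
have b3 : C * l ^+ 2 * (65 * s ^+ 2) <= l * s ^+ 2 / 4.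
  have -> : C * l ^+ 2 * (65 * s ^+ 2) = 260 * C * l * (l * s ^+ 2 / 4).
    by field.
  by rewrite -[leRHS]mul1r ler_wpM2r// divr_ge0// mulr_ge0 ?ltW.
have -> : - (4 / l) * I = (- I * 4) / l by ring.
by rewrite ler_pdivlMr//; lra.
Qed.

End Poincare.

Theorem proposition1p4 (R : realType) (E : completePseudoMetricType R)
    (hE : polish_space E)
    (dO : measure_display) (Omega : measurableType dO)
    (X : R -> Omega -> borel E) (Px : R.-pker (borel E) ~> Omega)
    (hX : markov_process X Px)
    (mu : probability (borel E) R)
    (hinv : invariant_measure X Px mu)
    (herg : ergodic_measure X Px mu)
    (hdiff : diffuse mu)
    (hLambda : exists C lambda0 : R, [/\ 0 < C, 0 < lambda0 &
      forall V : borel E -> R,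
        measurable_fun [set: borel E] V ->
        \int[mu]_x V x = 0 ->
        ereal_sup [set `|V x|%:E | x in [set: borel E]] = 1%E ->
        forall lambda : R, 0 <= lambda <= lambda0 ->
        (Lambda X Px mu (fun x => lambda * V x)%R
          <= (C * lambda ^+ 2)%:E)%E]) :
  poincare_inequality X Px mu.
Proof.
have [mX _ _] := hX; have [C [lambda0 [C0 lambda0_gt0 hV]]] := hLambda.
exact: (poincare_of_Lambda_bound mX hinv C0 lambda0_gt0 hV).
Qed.
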